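(* Let $m\ge\frac12$ and $\Omega>0$, and let $W$ be a complex Nakagami-$m$ random variable with shape parameter $m$ and variance $\Omega$. Then the differential entropy of $W$ is $$h(W)=\frac{1}{2\ln 2}\Psi(m)+\log\left(\frac{\pi\Omega}{m}\,\Gamma(m)\,e^{\frac{2m-(2m-1)\Psi(m)}{2}}\right).$$
   Context: $\log$ is base 2 and $\ln$ is the natural logarithm; $\Gamma$ is the Gamma function and $\Psi(x)=\frac{d}{dx}\ln\Gamma(x)$ is the Digamma function. A real Nakagami-$m$ random variable $X$ with shape parameter $m\ge\frac12$ and second-order moment $\Omega>0$ has PDF $f_X(x)=\frac{2}{\Gamma(m)}\left(\frac m\Omega\right)^m x^{2m-1}e^{-mx^2/\Omega}$ for $x\ge0$. A complex Nakagami-$m$ random variable with parameters $m,\Omega$ is $W=Xe^{j\Theta}$, where $X$ is real Nakagami-$m$ with parameters $m,\Omega$, and $\Theta$ is uniform on $[0,2\pi]$ and independent of $X$. The differential entropy (in bits) of a complex random variable is the joint differential entropy of its real and imaginary parts. *)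

(* Defs.v *)
From mathcomp Require Import all_boot all_order all_algebra.
From mathcomp Require Import all_classical all_reals all_analysis.
From mathcomp Require Import complex.

Set Implicit Arguments.
Unset Strict Implicit.
Unset Printing Implicit Defensive.

Import Order.TTheory GRing.Theory Num.Theory.
Import numFieldNormedType.Exports.

Local Open Scope classical_set_scope.
Local Open Scope ring_scope.

Section special_functions.
Context {R : realType}.

Definition log2 (x : R) : R := ln x / ln 2.

(* Euler's integral; meaningful for x > 0. *)
Definition Gamma (x : R) : R :=
  \int[lebesgue_measure]_(t in `]0, +oo[) (t `^ (x - 1) * expR (- t)).

Definition digamma (x : R) : R := derive1 (fun y : R => ln (Gamma y)) x.

End special_functions.

Section densities.
Context {d : measure_display} {T : measurableType d} {R : realType}.
Variable P : probability T R.

(* Density of the law of X with respect to mu. X is a bare function, so its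
   measurability is part of the predicate. *)
Definition has_pdf {d' : measure_display} {T' : measurableType d'}
    (mu : {measure set T' -> \bar R}) (X : T -> T') (f : T' -> R) : Prop :=
  [/\ measurable_fun setT X,
      measurable_fun setT f,
      forall x, 0 <= f x &
      forall A, measurable A ->
        P (X @^-1` A) = (\int[mu]_(x in A) (f x)%:E)%E].

(* Differential entropy in bits. A density is determined mu-almost everywhere
   (for sigma-finite mu), so the version picked is immaterial. As ln 0 = 0, the
   convention 0 log 0 = 0 holds. The value is -oo when there is no density, and
   the extended-real integral of a function whose positive and negative parts
   both have infinite integral is itself infinite; hence a finite value entails
   that a density exists and that f log f is integrable. *)
Definition differential_entropy {d' : measure_display}
    {T' : measurableType d'} (mu : {measure set T' -> \bar R})
    (X : T -> T') : \bar R :=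
  if pselect (exists f : T' -> R, has_pdf mu X f) is left exf then
    let f := sval (cid exf) in
    (- \int[mu]_x (f x * log2 (f x))%:E)%E
  else -oo%E.

Definition complex_differential_entropy (W : T -> R[i]) : \bar R :=
  differential_entropy
    ((@lebesgue_measure R) \x (@lebesgue_measure R))%E
    (fun t => (complex.Re (W t), complex.Im (W t))).

Definition independent_RV (X Y : {RV P >-> R}) : Prop :=
  forall A B : set R, measurable A -> measurable B ->
    P ((X @^-1` A) `&` (Y @^-1` B)) = (P (X @^-1` A) * P (Y @^-1` B))%E.

End densities.

Section nakagami.
Context {R : realType}.

Definition nakagami_pdf (m Omega x : R) : R :=
  if 0 <= x then
    2 / Gamma m * (m / Omega) `^ m * x `^ (2 * m - 1)
      * expR (- (m * x ^+ 2 / Omega))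
  else 0.

Context {d : measure_display} {T : measurableType d}.
Variable P : probability T R.

Definition real_nakagami (m Omega : R) (X : {RV P >-> R}) : Prop :=
  has_pdf P (@lebesgue_measure R) X (nakagami_pdf m Omega).

Definition uniform_RV (a b : R) (Theta : {RV P >-> R}) : Prop :=
  has_pdf P (@lebesgue_measure R) Theta (uniform_pdf a b).

Definition expi (theta : R) : R[i] := Complex (cos theta) (sin theta).

Definition complex_nakagami (m Omega : R) (W : T -> R[i]) : Prop :=
  exists X Theta : {RV P >-> R},
    [/\ real_nakagami m Omega X,
        uniform_RV 0 (2 * pi) Theta,
        independent_RV X Theta &
        forall t, W t = (real_complex R (X t)) * expi (Theta t)].

End nakagami.

(* Main.v *)
(* Put fX for the Nakagami density. By independence, W has law
   fX(r) dr d(theta) / 2 pi in polar coordinates, hence planar density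
   fX(|w|) / (2 pi |w|), and its entropy is a one-dimensional integral.
   Substituting y = ln (m r^2 / Omega) turns that integral into a combination of
   the integrals over the line of e^(my - e^y), y e^(my - e^y) and
   e^((m+1)y - e^y), which equal Gamma m, Gamma' m and m Gamma m.
   Polar coordinates come from one-dimensional substitutions and Tonelli: on the
   half-plane v > 0 put v = e^y and u = e^y t, exchange the integrals, translate y
   by the logarithm of (1 + t^2)^(1/2), and put t = cot theta. Since logarithmic
   radii are used throughout, every substitution has the whole line as target,
   and follows from the equality of two measures on half-open intervals. *)

Require Import Defs.
From HB Require Import structures.
From mathcomp Require Import all_boot all_order all_algebra.
From mathcomp Require Import all_classical all_reals all_analysis.
From mathcomp Require Import measurable_realfun simple_functions.
From mathcomp Require Import complex.
From mathcomp Require Import ring lra.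

Set Implicit Arguments.
Unset Strict Implicit.
Unset Printing Implicit Defensive.

Import Order.TTheory GRing.Theory Num.Theory.
Import numFieldNormedType.Exports.

Local Open Scope classical_set_scope.
Local Open Scope ring_scope.

(** * Densities and change of variables *)

Section density_measure.
Context {d : measure_display} {T : measurableType d} {R : realType}.
Variables (mu : {measure set T -> \bar R}) (w : T -> R).
Hypotheses (mw : measurable_fun setT w) (w0 : forall x, 0 <= w x).
Local Open Scope ereal_scope.

Import HBNNSimple.

(** Both sides commute with increasing limits of simple functions, and on an indicator the equality
    is the hypothesis on [nu]. That hypothesis is an equation, so the lemma serves distributions and
    restricted measures as well as [density_measure]. *)
Lemma ge0_integral_density (nu : {measure set T -> \bar R}) (f : T -> \bar R) :
  (forall A, measurable A -> nu A = \int[mu]_(x in A) (w x)%:E) ->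
  measurable_fun setT f -> (forall x, 0 <= f x) ->
  \int[nu]_x f x = \int[mu]_x (f x * (w x)%:E).
Proof.
move=> nuE mf f0; pose h := nnsfun_approx measurableT mf.
have mEw : measurable_fun setT (EFin \o w) by exact/measurable_EFinP.
have cvgh x : (h n x)%:E @[n --> \oo] --> f x by exact: cvg_nnsfun_approx.
have ndh x : {homo (fun n => (h n x)%:E) : n m / (n <= m)%N >-> n <= m}.
  by move=> a b ab; rewrite lee_fin; exact/lefP/nd_nnsfun_approx.
transitivity (limn (fun n => \int[nu]_x (h n x)%:E)).
  rewrite -monotone_convergence//; last 2 first.
  - by move=> n; exact/measurable_EFinP.
  - by move=> n x _; rewrite lee_fin.
  - by apply: eq_integral => x _; exact/esym/cvg_lim.
transitivity (limn (fun n => \int[mu]_x ((h n x)%:E * (w x)%:E))); last first.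
  rewrite -monotone_convergence//; last 3 first.
  - by move=> n; apply: emeasurable_funM => //; exact/measurable_EFinP.
  - by move=> n x _; rewrite mule_ge0// lee_fin.
  - by move=> x _ a b ab; rewrite lee_wpmul2r ?lee_fin// -lee_fin; exact: ndh.
  - by apply: eq_integral => x _; apply/cvg_lim => //; exact: cvgeZr.
apply: congr_lim; apply/funext => n.
transitivity (\int[nu]_x (\sum_(y \in range (h n))
    (y * \1_(h n @^-1` [set y]) x)%:E)).
  by apply: eq_integral => x _; rewrite fimfunE -fsumEFin.
rewrite ge0_integral_fsum//; last 2 first.
- by move=> y; apply/measurable_EFinP; exact: measurable_funM.
- by move=> y x _; exact: nnfun_muleindic_ge0.
transitivity (\int[mu]_x (\sum_(y \in range (h n))
    (y * \1_(h n @^-1` [set y]) x)%:E * (w x)%:E)); last first.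
  apply: eq_integral => x _; rewrite [in RHS]fimfunE -fsumEFin// ge0_mule_fsuml//.
  by move=> y; exact: nnfun_muleindic_ge0.
rewrite ge0_integral_fsum//; last 2 first.
- move=> y; apply: emeasurable_funM => //.
  by apply/measurable_EFinP; exact: measurable_funM.
- by move=> y x _; rewrite mule_ge0 ?lee_fin// -lee_fin; exact: nnfun_muleindic_ge0.
apply: eq_fsbigr => y /[!inE] -[z _ hzy].
have y0 : (0 <= y)%R by rewrite -hzy.
under eq_integral do rewrite EFinM.
under [RHS]eq_integral do rewrite EFinM -muleA.
rewrite !ge0_integralZl//; last 3 first.
- apply: emeasurable_funM => //; exact/measurable_EFinP.
- by move=> x _; rewrite mule_ge0// lee_fin.
- exact/measurable_EFinP.
rewrite integral_indic// setIT nuE//; congr (_ * _).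
rewrite [LHS]integral_mkcond; apply: eq_integral => x _.
by rewrite epatch_indic muleC.
Qed.

Definition density_measure : set T -> \bar R :=
  fun A => \int[mu]_(x in A) (w x)%:E.

Let density0 : density_measure set0 = 0.
Proof. by rewrite /density_measure integral_set0. Qed.

Let density_ge0 A : 0 <= density_measure A.
Proof. by apply: integral_ge0 => x _; rewrite lee_fin. Qed.

Let density_sigma_additive : semi_sigma_additive density_measure.
Proof.
move=> /= F mF tF mUF; rewrite /density_measure; apply: cvg_toP.
  apply: ereal_nondecreasing_is_cvgn => m n mn.
  apply: lee_sum_nneg_natr => // k _ _.
  by apply: integral_ge0 => /= x Fkx; rewrite lee_fin.
rewrite ge0_integral_bigcup//=.
- by apply: measurable_funTS; exact/measurable_EFinP.
- by move=> x _; rewrite lee_fin.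
Qed.

Definition density_measure_pack :=
  isMeasure.Build _ _ _ density_measure density0 density_ge0
    density_sigma_additive.
End density_measure.

Section change_of_variable.
Context {R : realType}.
Notation mu := (@lebesgue_measure R).
Local Open Scope ereal_scope.
Variables (D : set R) (phi : measurableTypeR R -> measurableTypeR R) (w : R -> R).
Hypotheses (mD : measurable D) (mphi : measurable_fun setT phi).
Hypotheses (mw : measurable_fun setT w) (w0 : forall x, (0 <= w x)%R).
Hypothesis phiE : forall a b, (a < b)%R ->
  mu (D `&` phi @^-1` `]a, b]) = \int[mu]_(y in `]a, b]) (w y)%:E.
Hypothesis phi_fin : forall a b, \int[mu]_(y in `]a, b]) (w y)%:E < +oo.

(** The image under [phi] of Lebesgue measure on [D] and the measure with density [w] agree on
    half-open intervals. These are stable under intersection and generate the Borel sets; by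
    [phi_fin] the intervals []-k, k]] have finite measure and exhaust the line, so the two measures
    coincide. *)
Lemma ge0_change_of_variable (f : R -> \bar R) :
  measurable_fun setT f -> (forall y, 0 <= f y) ->
  \int[mu]_(x in D) f (phi x) = \int[mu]_y (f y * (w y)%:E).
Proof.
move=> mf f0.
pose m2 : {measure set (measurableTypeR R) -> \bar R} :=
  HB.pack (density_measure mu w) (density_measure_pack mu mw w0).
pose m1 : {measure set (measurableTypeR R) -> \bar R} :=
    measure_function_pushforward__canonical__measure_function_Measure
      (mrestr mu mD) mphi.
have m12 A : measurable A -> m1 A = m2 A.
  move=> mA.
  apply: (@measure_unique _ R (measurableTypeR R) (@ocitv R)
      (fun k : nat => `](- k%:R)%R, k%:R]%classic) _ _ _ _ m1 m2 _ _ A mA).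
  - by [].
  - exact: ocitvI.
  - by move=> i; exact: is_ocitv.
  - rewrite -subTset => x _.
    have [n nx] : exists n : nat, (`|x| < n%:R)%R.
      by exists (Num.Def.truncn `|x|).+1; rewrite truncnS_gt.
    exists n => //=; rewrite in_itv/=.
    by move: nx; rewrite ltr_norml => /andP[-> /ltW].
  - move=> B /ocitvP[->|[[a b]/= ab ->]]; first by rewrite !measure0.
    by rewrite /m1 /= /pushforward /mrestr setIC phiE.
  - move=> k; rewrite /m1 /= /pushforward /mrestr setIC.
    (* [phiE] asks for [a < b]; for [k = 0] the interval is empty and is treated apart. *)
    have [k0|k0] := ltP (- k%:R)%R (k%:R : R)%R; first by rewrite phiE.
    by rewrite set_itv_ge ?preimage_set0 ?setI0 ?measure0// bnd_simp -leNgt.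
rewrite -(@ge0_integral_density _ _ _ mu w mw w0 m2)//.
rewrite -(@eq_measure_integral _ _ _ _ m2 m1); last by move=> A mA _; exact: m12.
rewrite (ge0_integral_pushforward mphi (mrestr mu mD))//.
rewrite preimage_setT [LHS]integral_mkcond.
(* Restriction to [D] is the measure with density the indicator of [D]. *)
transitivity (\int[mu]_x ((f (phi x)) * (\1_D x)%:E)).
  by apply: eq_integral => x _; rewrite epatch_indic.
rewrite -(@ge0_integral_density _ _ _ mu (\1_D) _ _ (mrestr mu mD))//.
- by move=> A mA; rewrite integral_indic// /mrestr setIC.
- exact: measurableT_comp.
Qed.

End change_of_variable.

Section substitutions.
Context {R : realType}.
Notation mu := (@lebesgue_measure R).

Lemma measurable_inv : measurable_fun setT (@GRing.inv R).
Proof.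
rewrite -(setvU [set 0 : R]) setUC; apply/measurable_funU => //.
  exact: measurableC.
split; first exact: measurable_fun_set1.
apply: open_continuous_measurable_fun; first exact: closed_openC.
by move=> x; rewrite inE/= => /eqP x0; exact: inv_continuous.
Qed.

Lemma measurable_sin : measurable_fun setT (@sin R).
Proof. by apply: continuous_measurable_fun; exact: continuous_sin. Qed.

Lemma measurable_cos : measurable_fun setT (@cos R).
Proof. by apply: continuous_measurable_fun; exact: continuous_cos. Qed.

Local Open Scope ereal_scope.

Lemma integral_is_derive (F f : R -> R) a b : (a < b)%R ->
  continuous f -> (forall x, is_derive x (1 : R)%R F (f x)) ->
  \int[mu]_(y in `]a, b]) (f y)%:E = (F b - F a)%:E.
Proof.
move=> ab cf dF.
rewrite integral_itv_obnd_cbnd; last first.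
  apply/measurable_EFinP/measurable_funTS; exact: continuous_measurable_fun.
have cF : continuous F.
  move=> x; apply/differentiable_continuous/derivable1_diffP.
  exact: ex_derive.
rewrite (@continuous_FTC2 _ f F)//.
- exact: continuous_subspaceT.
- split => //; last by apply: cvg_at_left_filter; exact: cF.
  by apply: cvg_at_right_filter; exact: cF.
- by move=> x _; rewrite derive1E; exact: derive_val.
Qed.

(** [psi] plays the inverse of [phi], up to orientation and an additive constant: [expR] for [ln],
    [atan] for the cotangent. What remains for each substitution is the preimage of one interval. *)
Lemma ge0_change_of_variable_derive (D : set R) (phi : R -> R) (psi w : R -> R)
    (f : R -> \bar R) :
  measurable D -> measurable_fun setT phi ->
  continuous w -> (forall x, (0 <= w x)%R) ->
  (forall x, is_derive x (1 : R)%R psi (w x)) ->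
  (forall a b, (a < b)%R ->
    mu (D `&` phi @^-1` `]a, b]) = (psi b - psi a)%:E) ->
  measurable_fun setT f -> (forall y, 0 <= f y) ->
  \int[mu]_(x in D) f (phi x) = \int[mu]_y (f y * (w y)%:E).
Proof.
move=> mD mphi cw w0 dpsi phiE mf f0.
apply: (ge0_change_of_variable mD mphi _ w0) => //.
- exact: continuous_measurable_fun.
- by move=> a b ab; rewrite phiE// (integral_is_derive ab cw dpsi).
- move=> a b; have [ab|ba] := ltP a b.
    by rewrite (integral_is_derive ab cw dpsi) ltry.
  by rewrite set_itv_ge ?integral_set0// bnd_simp -leNgt.
Qed.

Lemma ge0_integral_ln (f : R -> \bar R) :
  measurable_fun setT f -> (forall y, 0 <= f y) ->
  \int[mu]_(x in `]0%R, +oo[) f (ln x) = \int[mu]_y (f y * (expR y)%:E).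
Proof.
move=> mf f0.
apply: (@ge0_change_of_variable_derive _ (@ln R) expR) => //.
- exact: continuous_expR.
- move=> a b ab.
  rewrite (_ : _ `&` _ = `]expR a, expR b]%classic); last first.
    apply/seteqP; split => x /=; rewrite !in_itv/= ?andbT.
      by move=> [x0 /andP[ax xb]]; rewrite -(@lnK _ x)// ltr_expR ler_expR ax xb.
    move=> /andP[ax xb]; have x0 : (0 < x)%R by rewrite (lt_trans _ ax)// expR_gt0.
    by split => //; rewrite -ltr_expR -ler_expR lnK// ax xb.
  by rewrite lebesgue_measure_itv/= lte_fin ltr_expR ab EFinB.
Qed.

Lemma ge0_integral_affine (a b : R) (f : R -> \bar R) : (a != 0)%R ->
  measurable_fun setT f -> (forall y, 0 <= f y) ->
  \int[mu]_x f x = \int[mu]_y (f (a * y + b)%R * (`|a|%R)%:E).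
Proof.
move=> a0 mf f0.
transitivity (\int[mu]_x f (a * (a^-1 * (x - b)) + b)%R).
  by apply: eq_integral => x _; rewrite mulrA mulfV// mul1r subrK.
apply: (@ge0_change_of_variable_derive setT (fun x => a^-1 * (x - b))%R
  (fun y => `|a| * y)%R (fun=> `|a|%R) (fun y => f (a * y + b)%R)) => //.
- by apply: measurable_funM => //; exact: measurable_funB.
- by move=> x; exact: cvg_cst.
- move=> x; have := @is_deriveZ _ _ _ id `|a|%R x 1%R 1%R _.
  by rewrite /GRing.scale/= mulr1; apply.
- move=> c d cd; rewrite setTI.
  (* A negative slope reverses the interval and moves its closed end to the left; the length is
     unaffected. *)
  have [an|ap|] := ltgtP a 0%R; last by move/eqP; rewrite (negbTE a0).
  + rewrite (_ : _ @^-1` _ = `[a * d + b, a * c + b[%classic)%R; last first.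
      apply/seteqP; split => x /=; rewrite !in_itv/=.
        move=> /andP[]; rewrite ltr_ndivlMl// ler_ndivrMl// => ? ?.
        by apply/andP; split; lra.
      move=> /andP[? ?]; rewrite ltr_ndivlMl// ler_ndivrMl//.
      by apply/andP; split; lra.
    rewrite lebesgue_measure_itv/= lte_fin ltrD2r ltr_nM2l// cd -EFinB.
    by congr EFin; rewrite ltr0_norm//; ring.
  + rewrite (_ : _ @^-1` _ = `]a * c + b, a * d + b]%classic)%R; last first.
      apply/seteqP; split => x /=; rewrite !in_itv/=.
        move=> /andP[]; rewrite ltr_pdivlMl// ler_pdivrMl// => ? ?.
        by apply/andP; split; lra.
      move=> /andP[? ?]; rewrite ltr_pdivlMl// ler_pdivrMl//.
      by apply/andP; split; lra.
    rewrite lebesgue_measure_itv/= lte_fin ltrD2r ltr_pM2l// cd -EFinB.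
    by congr EFin; rewrite gtr0_norm//; ring.
- by apply: measurableT_comp => //; apply: measurable_funD.
Qed.

Lemma ge0_integral_cot (f : R -> \bar R) :
  measurable_fun setT f -> (forall y, 0 <= f y) ->
  \int[mu]_(x in `]0%R, pi[) f (cos x / sin x)%R =
  \int[mu]_y (f y * ((1 + y ^+ 2)^-1)%:E).
Proof.
move=> mf f0.
have atan_lt := leW_mono (le_mono (@lt_atan R)).
have atan_le := le_mono (@lt_atan R).
apply: (@ge0_change_of_variable_derive _ (fun x => cos x / sin x)%R atan) => //.
- apply: measurable_funM; first exact: measurable_cos.
  by apply: measurableT_comp; [exact: measurable_inv|exact: measurable_sin].
- move=> x; apply: cvgV; first by rewrite gt_eqF// ltr_pwDl// sqr_ge0.
  by apply: cvgD; [exact: cvg_cst|exact: exprn_continuous].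
- by move=> x; rewrite invr_ge0 addr_ge0// sqr_ge0.
- move=> a b ab.
  rewrite (_ : _ `&` _ = `[pi / 2 - atan b, pi / 2 - atan a[%classic)%R; last first.
    have cotP x : (0 < x < pi)%R ->
        (a < cos x / sin x <= b)%R = (pi / 2 - atan b <= x < pi / 2 - atan a)%R.
      move=> /andP[x0 xpi].
      (* The argument [pi / 2 - x] lies in the range of [atan], so comparing tangents amounts to
         comparing angles. *)
      have -> : (cos x / sin x = tan (pi / 2 - x))%R.
        by rewrite /tan -opprB sinN cosN sinBpihalf cosBpihalf opprK.
      rewrite -atan_lt -[(_ <= b)%R]atan_le tanK; last by rewrite in_itv/=; lra.
      by apply/andP/andP => -[? ?]; split; lra.
    apply/seteqP; split => x /=; rewrite !in_itv/=.
      by move=> [/cotP <-].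
    have := atan_gtNpi2 a; have := atan_ltpi2 b => hb ha xab.
    have x0pi : (0 < x < pi)%R by lra.
    by rewrite cotP.
  rewrite lebesgue_measure_itv/= lte_fin ltrD2l ltrN2 atan_lt ab -EFinB.
  by congr EFin; ring.
Qed.
End substitutions.

(** * Logarithmic polar coordinates *)

Section polar_coordinates.
Context {R : realType}.
Notation mu := (@lebesgue_measure R).
Notation RR := (measurableTypeR R * measurableTypeR R)%type.
Local Open Scope ereal_scope.

Let measurable_section (F : RR -> \bar R) (g h : RR -> R) :
  measurable_fun setT F -> measurable_fun setT g -> measurable_fun setT h ->
  measurable_fun setT (fun z : RR => F (g z, h z)).
Proof.
move=> mF mg mh; apply: (measurableT_comp mF).
by apply/measurable_fun_pairP; split.
Qed.

(** With radius r = e^x, the area factor r dr becomes e^(2x) dx, whence the square of [expR x]. *)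
Let half_plane_polar (F : RR -> \bar R) :
  measurable_fun setT F -> (forall z, 0 <= F z) ->
  \int[mu]_(v in `]0%R, +oo[) \int[mu]_u F (u, v) =
  \int[mu]_(theta in `]0%R, pi[)
    \int[mu]_x (F (expR x * cos theta, expR x * sin theta)%R * (expR x ^+ 2)%:E).
Proof.
move=> mF F0.
pose H (v : R) := \int[mu]_u F (u, v).
have mH : measurable_fun setT H.
  exact: (@measurable_fun_fubini_tonelli_G _ _ _ _ _ mu F).
have H0 v : 0 <= H v by exact: integral_ge0.
transitivity (\int[mu]_(v in `]0%R, +oo[) H (expR (ln v))).
  by apply: eq_integral => v; rewrite inE/= in_itv/= andbT => v0; rewrite lnK.
rewrite (ge0_integral_ln (f := H \o expR))//; last first.
  by move=> y; exact: H0.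
  exact: measurableT_comp.
(* In [K (t, y)], each of the substitutions v = e^y and u = e^y t contributes one factor e^y. *)
pose K (z : RR) := F (expR z.2 * z.1, expR z.2)%R * (expR z.2 ^+ 2)%:E.
have mexp2 : measurable_fun setT (fun z : RR => expR z.2).
  by apply: measurableT_comp => //; exact: measurable_snd.
have mexp22 : measurable_fun setT (fun z : RR => (expR z.2 ^+ 2)%:E).
  by apply/measurable_EFinP; exact: measurable_funX.
have mK : measurable_fun setT K.
  apply: emeasurable_funM => //; apply: measurable_section => //.
  by apply: measurable_funM => //; exact: measurable_fst.
have K0 z : 0 <= K z by rewrite mule_ge0// lee_fin sqr_ge0.
transitivity (\int[mu]_y \int[mu]_t K (t, y)).
  apply: eq_integral => y _; rewrite /= /H.
  have mFy : measurable_fun setT (fun u : R => F (u, expR y)).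
    exact: (measurable_fun_pair1 (expR y) mF).
  rewrite (ge0_integral_affine 0 (lt0r_neq0 (expR_gt0 y)) mFy)//.
  rewrite -ge0_integralZr//.
  - apply: eq_integral => t _.
    by rewrite -muleA -EFinM gtr0_norm ?expR_gt0// addr0 -expr2.
  - apply: emeasurable_funM => //; apply: (measurableT_comp mFy).
    by apply: measurable_funD => //; exact: measurable_funM.
  - by move=> x _; rewrite mule_ge0.
transitivity (\int[mu]_t \int[mu]_y K (t, y)).
  exact/esym/(fubini_tonelli (m1 := mu) (m2 := mu) K mK K0).
(* For t = cot theta with theta in []0, pi[], [k t] is sin theta and [k t * t] is cos theta.
   Translating y by [ln (k t)] therefore produces the polar point, and the factor [k t ^+ 2] that it
   releases is the weight of the cotangent substitution. *)
pose k (t : R) := (Num.sqrt (1 + t ^+ 2))^-1%R.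
have t1_gt0 (t : R) : (0 < 1 + t ^+ 2)%R by rewrite ltr_pwDl// sqr_ge0.
have k_gt0 t : (0 < k t)%R by rewrite invr_gt0 sqrtr_gt0.
have k2 t : (k t ^+ 2 = (1 + t ^+ 2)^-1)%R by rewrite exprVn sqr_sqrtr// ltW.
have mk : measurable_fun setT k.
  apply: (measurableT_comp (@measurable_inv R)).
  apply: continuous_measurable_fun => t.
  apply: continuous_comp; last exact: sqrt_continuous.
  by apply: cvgD; [exact: cvg_cst|exact: exprn_continuous].
pose K' (z : RR) :=
  F (expR z.2 * (k z.1 * z.1), expR z.2 * k z.1)%R * (expR z.2 ^+ 2)%:E.
have mk1 : measurable_fun setT (fun z : RR => k z.1).
  by apply: (measurableT_comp mk); exact: measurable_fst.
have mK' : measurable_fun setT K'.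
  apply: emeasurable_funM => //; apply: measurable_section => //.
    by apply: measurable_funM => //; apply: measurable_funM.
  by apply: measurable_funM => //; exact: measurable_fst.
have K'0 z : 0 <= K' z by rewrite mule_ge0// lee_fin sqr_ge0.
pose G (t : R) := \int[mu]_x K' (t, x).
have mG : measurable_fun setT G.
  exact: (@measurable_fun_fubini_tonelli_F _ _ _ _ _ mu K').
have G0 t : 0 <= G t by exact: integral_ge0.
transitivity (\int[mu]_t (G t * ((1 + t ^+ 2)^-1)%:E)).
  apply: eq_integral => t _.
  have mKt : measurable_fun setT (fun y : R => K (t, y)).
    exact: (measurable_fun_pair2 t mK).
  have mKt' : measurable_fun setT (fun y : R => K' (t, y)).
    exact: (measurable_fun_pair2 t mK').
  rewrite (ge0_integral_affine (ln (k t)) (oner_neq0 R) mKt)//.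
  rewrite -ge0_integralZr//; last by rewrite lee_fin -k2 sqr_ge0.
  apply: eq_integral => x _; rewrite normr1 mule1 mul1r /K /K' /=.
  rewrite expRD lnK ?posrE// -k2 -muleA -EFinM exprMn.
  by rewrite -[(expR x * k t * t)%R]mulrA.
rewrite -(ge0_integral_cot mG G0).
apply: eq_integral => theta; rewrite inE/= in_itv/= => th.
have s0 := sin_gt0_pi th.
have kE : (k (cos theta / sin theta) = sin theta)%R.
  rewrite /k (_ : 1 + _ = (sin theta)^-1 ^+ 2)%R; last first.
    have s20 : (sin theta ^+ 2 != 0)%R by rewrite sqrf_eq0 gt_eqF// s0.
    apply: (mulIf s20); rewrite mulrDl mul1r expr_div_n divfK// exprVn mulVf//.
    by rewrite addrC cos2Dsin2.
  by rewrite sqrtr_sqr gtr0_norm ?invr_gt0 ?s0// invrK.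
apply: eq_integral => x _; rewrite /K'/= kE.
by rewrite [(sin theta * _)%R]mulrCA mulfV ?mulr1// gt_eqF// s0.
Qed.

(** The upper half-plane is the case already treated. The point reflection z -> -z carries the lower
    one onto it and shifts the angle by [pi]. Single angles and the line v = 0 are negligible. *)
Lemma ge0_integral_polar (F : RR -> \bar R) :
  measurable_fun setT F -> (forall z, 0 <= F z) ->
  \int[mu \x mu]_z F z =
  \int[mu]_(theta in `[0%R, (2 * pi)%R])
    \int[mu]_x (F (expR x * cos theta, expR x * sin theta)%R * (expR x ^+ 2)%:E).
Proof.
move=> mF F0.
pose J (theta : R) := \int[mu]_x
  (F (expR x * cos theta, expR x * sin theta)%R * (expR x ^+ 2)%:E).
have mJ : measurable_fun setT J.
  apply: (@measurable_fun_fubini_tonelli_F _ _ _ _ _ mu (fun z : RR =>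
    F (expR z.2 * cos z.1, expR z.2 * sin z.1)%R * (expR z.2 ^+ 2)%:E)).
    apply: emeasurable_funM; last first.
      apply/measurable_EFinP/measurable_funX; apply: measurableT_comp => //.
    apply: measurable_section => //; apply: measurable_funM => //. 
    - by apply: measurableT_comp => //; exact: measurable_snd.
    - by apply: (measurableT_comp measurable_cos); exact: measurable_fst.
    - by apply: measurableT_comp => //; exact: measurable_snd.
    - by apply: (measurableT_comp measurable_sin); exact: measurable_fst.
  by move=> z; rewrite mule_ge0// lee_fin sqr_ge0.
have J0 theta : 0 <= J theta.
  by apply: integral_ge0 => x _; rewrite mule_ge0// lee_fin sqr_ge0.
transitivity (\int[mu]_(theta in `]0%R, pi[) J theta +
              \int[mu]_(theta in `]pi, (2 * pi)%R[) J theta); last first.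
  have pi0 := pi_gt0 R.
  rewrite -[RHS]integral_itv_obnd_cbnd; last exact: measurable_funTS.
  rewrite -integral_itv_bndo_bndc; last exact: measurable_funTS.
  rewrite (_ : `]0%R, (2 * pi)%R[%classic =
      `]0%R, pi] `|` `]pi, (2 * pi)%R[); last first.
    apply/seteqP; split => x /=; rewrite !in_itv/=.
      by move=> xpi; have [?|?] := leP x pi; [left|right]; lra.
    by move=> []; lra.
  rewrite ge0_integral_setU//.
  - by congr (_ + _); rewrite integral_itv_bndo_bndc//; exact: measurable_funTS.
  - exact: measurable_funTS.
  - by move=> x _; exact: J0.
  - apply/disj_setPS => x [] /=; rewrite !in_itv/= => /andP[_ h] /andP[].
    by rewrite ltNge h.
rewrite (fubini_tonelli2 (m1 := mu) (m2 := mu) F mF F0) /fubini_G.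
pose H (v : R) := \int[mu]_u F (u, v).
have mH : measurable_fun setT H.
  exact: (@measurable_fun_fubini_tonelli_G _ _ _ _ _ mu F).
have H0 v : 0 <= H v by exact: integral_ge0.
have HE v : \int[mu]_u F (u, v) = H v by [].
under eq_integral do rewrite HE.
clearbody H.
(* The lower half-plane is folded onto positive v. *)
transitivity (\int[mu]_(v in `]0%R, +oo[) H v +
              \int[mu]_(v in `]0%R, +oo[) H (- v)%R).
  rewrite (_ : setT = `]0%R, +oo[ `|` `]-oo, 0%R]); last first.
    apply/seteqP; split => x //= _; rewrite !in_itv/= andbT.
    by have [?|?] := leP x 0%R; [right|left].
  rewrite ge0_integral_setU//; last 2 first.
  - exact: measurable_funTS.
  - apply/disj_setPS => x [] /=; rewrite !in_itv/= andbT => h.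
    by rewrite leNgt h.
  congr (_ + _).
  have mHN : measurable_fun setT (fun v : R => H (- v)%R) by exact: measurableT_comp.
  rewrite integral_itv_obnd_cbnd; last exact: measurable_funTS.
  rewrite ge0_integration_by_substitution0//.
  by apply: eq_integral => v _; rewrite opprK.
congr (_ + _); first by under eq_integral do rewrite -HE; exact: half_plane_polar.
have mFN : measurable_fun setT (fun z : RR => F (- z.1, - z.2)%R).
  by apply: measurable_section => //; apply: measurableT_comp.
transitivity (\int[mu]_(v in `]0%R, +oo[) \int[mu]_u F (- u, - v)%R).
  apply: eq_integral => v _; rewrite -HE.
  have mFv : measurable_fun setT (fun u : R => F (u, - v)%R).
    exact: (measurable_fun_pair1 (- v)%R mF).
  have N1_neq0 : (-1 != 0 :> R)%R by rewrite oppr_eq0 oner_eq0.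
  rewrite (ge0_integral_affine 0 N1_neq0 mFv)//.
  by apply: eq_integral => u _; rewrite normrN1 mule1 mulN1r addr0.
have FN0 (z : RR) : 0 <= F (- z.1, - z.2)%R by exact: F0.
etransitivity; first exact: (half_plane_polar mFN FN0).
rewrite [LHS]integral_mkcond [RHS]integral_mkcond.
(* Angles in []pi, 2 * pi[] are translated to []0, pi[], where cosine and sine both change sign. *)
have mJr : measurable_fun setT (J \_ `]pi, (2 * pi)%R[).
  by apply/(measurable_restrictT J) => //; exact: measurable_funTS.
rewrite (ge0_integral_affine pi (oner_neq0 R) mJr); last first.
  by move=> x; exact: erestrict_ge0.
apply: eq_integral => theta _.
rewrite normr1 mule1 mul1r !patchE !mem_setE !in_itv/=.
rewrite (_ : (pi < theta + pi < 2 * pi)%R = (0 < theta < pi)%R); last first.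
  by apply/andP/andP => -[? ?]; split; lra.
case: ifPn => // _; apply: eq_integral => x _.
by rewrite cosDpi sinDpi !mulrN.
Qed.

End polar_coordinates.

(** * The Gamma function *)

(** Dominated differentiation on a neighbourhood []u, v[] of [a], giving derivability and value in
    one statement. The derivative of the integrand is supplied as [df], so that the domination
    concerns an explicit function. *)
Lemma is_derive_under_integral (R : realType) (d : measure_display)
    (Y : measurableType d) (mu : {measure set Y -> \bar R})
    (f df : R -> Y -> R) (G : Y -> R) (a u v : R) :
  u < a < v ->
  (forall x, u < x < v -> mu.-integrable setT (EFin \o f x)) ->
  (forall x y, u < x < v -> is_derive x (1 : R) (f ^~ y) (df x y)) ->
  (forall x y, u < x < v -> `|df x y| <= G y) ->
  mu.-integrable setT (EFin \o G) ->
  is_derive a (1 : R) (fun x => \int[mu]_y f x y) (\int[mu]_y df a y).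
Proof.
move=> auv fi fdf dfG Gi.
have Ia : `]u, v[%classic a by rewrite /= in_itv.
have Iin x : `]u, v[%classic x -> u < x < v by rewrite /= in_itv.
have G0 y : 0 <= G y by exact: le_trans (dfG a y auv).
have dfE x y : u < x < v -> partial1of2 f x y = df x y.
  by move=> h; rewrite partial1of2E; have fxy := fdf x y h; rewrite derive_val.
have fi' x (Ix : `]u, v[%classic x) := fi x (Iin x Ix).
have fd' x y (Ix : `]u, v[%classic x) (_ : setT y) : derivable (f ^~ y) x 1.
  by have fxy := fdf x y (Iin x Ix); exact: ex_derive.
have Gb x y (Ix : `]u, v[%classic x) (_ : setT y) : `|partial1of2 f x y| <= G y.
  by rewrite dfE ?Iin// dfG// Iin.
apply: DeriveDef.
  exact: (derivable_under_integral measurableT Ia fi' fd' G0 Gi Gb).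
rewrite -derive1E (differentiation_under_integral measurableT Ia fi' fd' G0 Gi Gb).
by apply: eq_Rintegral => y _; rewrite dfE.
Qed.

Section gamma_function.
Context {R : realType}.
Notation mu := (@lebesgue_measure R).

(** The cotangent substitution applied to the constant 1 identifies the integral with the length of
    []0, pi[]. *)
Lemma integrable_inv1Dsqr :
  mu.-integrable setT (EFin \o (fun y : R => (1 + y ^+ 2)^-1)).
Proof.
have minv : measurable_fun setT (fun y : R => (1 + y ^+ 2)^-1).
  apply: (measurableT_comp measurable_inv).
  by apply: measurable_funD => //; exact: measurable_funX.
apply/integrableP; split; first exact/measurable_EFinP.
have := @ge0_integral_cot R (cst 1%E) _ _.
under [in X in _ = X]eq_integral do rewrite /= mul1e.
rewrite integral_cst//= mul1e lebesgue_measure_itv/= lte_fin pi_gt0 oppr0 adde0 => h.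
under eq_integral do rewrite /= ger0_norm ?invr_ge0 ?addr_ge0 ?sqr_ge0//.
by rewrite -h// ltry.
Qed.

(* The change of variable t = e^y turns Euler's integral for Gamma s into the
   integral of [gamma_kernel s 1] over the whole line. *)
Definition gamma_kernel (s a y : R) : R := expR (s * y - a * expR y).

Lemma gamma_kernel_ge0 s a y : 0 <= gamma_kernel s a y.
Proof. exact: expR_ge0. Qed.

Lemma measurable_gamma_kernel s a : measurable_fun setT (gamma_kernel s a).
Proof.
apply: measurableT_comp => //; apply: measurable_funB.
  exact: measurable_funM.
by apply: measurable_funM.
Qed.

(** The kernel is at most [M] e^(-s|y|): on the left e^(s y) decays, on the right e^(-a e^y) wins.
    Exponential decay then beats 1 + y^2 up to the factor [K]. *)
Lemma gamma_kernel_le s a : 0 < s -> 0 < a ->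
  exists2 C : R, 0 <= C & forall y, gamma_kernel s a y <= C * (1 + y ^+ 2)^-1.
Proof.
move=> s0 a0.
(* At [c] the tangent to a e^y has slope 2s, so a e^y >= 2s (1 + y - c); this turns growth at rate s
   into decay at rate s and leaves the constant e^(2s(c - 1)). *)
pose c := ln (2 * s / a).
pose K := 1 + 4 / s ^+ 2; pose M := 1 + expR (2 * s * (c - 1)).
have K0 : 0 <= K by rewrite addr_ge0// divr_ge0// sqr_ge0.
have M0 : 0 <= M by rewrite addr_ge0// expR_ge0.
exists (K * M); first exact: mulr_ge0.
move=> y; rewrite ler_pdivlMr ?ltr_pwDl ?sqr_ge0// mulrC.
have yK : 1 + y ^+ 2 <= K * expR (s * `|y|).
  have h : 1 + s ^+ 2 * y ^+ 2 / 4 <= expR (s * `|y|).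
    (* Halving the exponent gives e^(2z) >= (1 + z)^2 >= 1 + z^2. *)
    pose z := s * `|y| / 2.
    have z0 : 0 <= z by rewrite divr_ge0// mulr_ge0// ltW.
    have -> : s ^+ 2 * y ^+ 2 / 4 = z ^+ 2.
      by rewrite -[y ^+ 2]real_normK ?num_real// /z; field.
    rewrite (_ : s * `|y| = z + z); last by rewrite /z; field.
    by rewrite expRD; have := expR_ge1Dx z; nra.
  apply: (@le_trans _ _ (K * (1 + s ^+ 2 * y ^+ 2 / 4))); last exact: ler_wpM2l.
  rewrite /K; have -> : (1 + 4 / s ^+ 2) * (1 + s ^+ 2 * y ^+ 2 / 4)
    = 1 + y ^+ 2 + 4 / s ^+ 2 + s ^+ 2 * y ^+ 2 / 4 by field; rewrite gt_eqF.
  rewrite -addrA lerDl addr_ge0//; first by rewrite divr_ge0// sqr_ge0.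
  by rewrite divr_ge0// mulr_ge0// sqr_ge0.
apply: (@le_trans _ _ (K * expR (s * `|y|) * gamma_kernel s a y)).
  by rewrite ler_wpM2r// gamma_kernel_ge0.
rewrite -mulrA ler_wpM2l// /gamma_kernel -expRD /M.
have [y0|y0] := lerP 0 y.
  apply: (@le_trans _ _ (expR (2 * s * (c - 1)))); last by rewrite lerDr.
  rewrite ler_expR ger0_norm//.
  have ec : a * expR c = 2 * s.
    by rewrite lnK ?posrE ?divr_gt0 ?mulr_gt0// mulrC divfK ?gt_eqF.
  have -> : expR y = expR c * expR (y - c) by rewrite -expRD addrC subrK.
  have := expR_ge1Dx (y - c); rewrite mulrA ec; nra.
apply: (@le_trans _ _ 1); last by rewrite lerDl expR_ge0.
rewrite -expR0 ler_expR ltr0_norm// mulrN addrA addNr add0r oppr_le0.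
by rewrite mulr_ge0 ?expR_ge0// ltW.
Qed.

Lemma integrable_gamma_kernel s a : 0 < s -> 0 < a ->
  mu.-integrable setT (EFin \o gamma_kernel s a).
Proof.
move=> s0 a0; have [C C0 kC] := gamma_kernel_le s0 a0.
apply: (le_integrable measurableT _ _
  (integrableZl measurableT C integrable_inv1Dsqr)).
  by apply/measurable_EFinP; exact: measurable_gamma_kernel.
move=> y _; rewrite /= lee_fin ger0_norm ?gamma_kernel_ge0//.
by rewrite (le_trans (kC y))// ler_norm.
Qed.

Lemma GammaE s : Gamma s = \int[mu]_y gamma_kernel s 1 y.
Proof.
rewrite /Gamma /Rintegral; congr fine.
pose f (y : R) := (expR ((s - 1) * y - expR y))%:E.
transitivity (\int[mu]_(t in `]0%R, +oo[) f (ln t))%E.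
  apply: eq_integral => t; rewrite inE/= in_itv/= andbT => t0.
  by rewrite /f lnK ?posrE// /powR gt_eqF// expRD.
rewrite ge0_integral_ln//.
- apply: eq_integral => y _; rewrite /f -EFinM -expRD; congr (expR _)%:E; ring.
- apply/measurable_EFinP; apply: (measurableT_comp (@measurable_expR R)).
  by apply: measurable_funB => //; exact: measurable_funM.
- by move=> y; rewrite lee_fin expR_ge0.
Qed.

(** On [[0, 1]] the kernel is at least e^(-e), so the integral is at least that number. *)
Lemma Gamma_gt0 (s : R) : 0 < s -> 0 < Gamma s.
Proof.
move=> s0; rewrite GammaE.
apply: (@lt_le_trans _ _ (expR (- expR 1))); first exact: expR_gt0.
rewrite -lee_fin /Rintegral fineK; last first.
  by apply: integrable_fin_num => //; exact: integrable_gamma_kernel.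
have -> : (expR (- expR 1))%:E =
    (\int[mu]_(x in `[0%R, 1%R]) (expR (- expR 1))%:E)%E :> \bar R.
  by rewrite integral_cst//= lebesgue_measure_itv/= lte_fin ltr01 -EFinB subr0 mule1.
apply: (@le_trans _ _ (\int[mu]_(x in `[0%R, 1%R]) (gamma_kernel s 1 x)%:E)%E).
  apply: ge0_le_integral => //.
  - by apply/measurable_EFinP/measurable_funTS; exact: measurable_gamma_kernel.
  - move=> x /=; rewrite in_itv/= => /andP[x0 x1].
    rewrite lee_fin ler_expR mul1r lerBrDr addrC lerBlDr.
    by rewrite (le_trans (_ : _ <= expR 1)) ?ler_expR// lerDr mulr_ge0// ltW.
apply: ge0_subset_integral => //.
- by apply/measurable_EFinP; exact: measurable_gamma_kernel.
- by move=> x _; rewrite lee_fin gamma_kernel_ge0.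
Qed.

Lemma is_derive_gamma_kernel_shape (s a y : R) :
  is_derive s (1 : R) (fun s => gamma_kernel s a y) (y * gamma_kernel s a y).
Proof.
rewrite mulrC.
apply: (is_derive1_comp (f := expR) (g := fun s => s * y - a * expR y)).
have := is_deriveD (is_deriveZ y (is_derive_id s (1 : R)))
  (is_derive_cst (- (a * expR y)) s (1 : R)).
rewrite addr0 /GRing.scale/= mulr1.
suff -> : y \*: id + cst (- (a * expR y)) = (fun s => s * y - a * expR y) by [].
by apply/funext => t; rewrite !fctE; congr (_ - _); exact: mulrC.
Qed.

(** Differentiating in the rate multiplies by -e^y, which raises the shape by one; this is how Gamma
    (s + 1) enters. *)
Lemma is_derive_gamma_kernel_rate (s a y : R) :
  is_derive a (1 : R) (gamma_kernel s ^~ y) (- gamma_kernel (s + 1) a y).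
Proof.
have -> : - gamma_kernel (s + 1) a y = gamma_kernel s a y * - expR y.
  by rewrite /gamma_kernel mulrN -expRD; congr (- expR _); ring.
apply: (is_derive1_comp (f := expR) (g := fun a => s * y - a * expR y)).
have := is_deriveD (is_derive_cst (s * y) a (1 : R))
  (is_deriveZ (- expR y) (is_derive_id a (1 : R))).
rewrite add0r /GRing.scale/= mulr1.
suff -> : cst (s * y) + (- expR y) \*: id = (fun a => s * y - a * expR y) by [].
apply/funext => t; rewrite !fctE; congr (_ + _).
by rewrite -mulrN mulrC.
Qed.

(** Differentiation in the shape under the integral sign. The dominating function also yields the
    integrability of the derivative, which the entropy integral requires in order to be split. *)
Lemma is_derive_Gamma (s : R) : 0 < s ->
  is_derive s (1 : R) Gamma (\int[mu]_y (y * gamma_kernel s 1 y)) /\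
  mu.-integrable setT (fun y => (y * gamma_kernel s 1 y)%:E).
Proof.
move=> s0.
(* For t between s/2 = 2b and 2s = 8b, the bound |y| <= (e^(by) + e^(-by)) / b moves the shape by b
   either way, hence within [[b, 9 * b]]. There the kernel is below the sum of the two extreme
   kernels, according to the sign of y; the two moved terms account for the 2 in [2 / b]. *)
pose b := s / 4; have b0 : 0 < b by rewrite divr_gt0.
pose G y := 2 / b * (gamma_kernel b 1 y + gamma_kernel (9 * b) 1 y).
have Gi : mu.-integrable setT (EFin \o G).
  have b90 : 0 < 9 * b by rewrite mulr_gt0.
  have := integrableZl measurableT (2 / b)
    (integrableD measurableT (integrable_gamma_kernel b0 ltr01)
      (integrable_gamma_kernel b90 ltr01)).
  by apply: eq_integrable.
have yG t y : s / 2 < t < 2 * s -> `|y * gamma_kernel t 1 y| <= G y.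
  have -> : s = 4 * b by rewrite /b mulrC divfK.
  move=> /andP[tl tu].
  pose Y (r : R) := gamma_kernel r 1 y.
  have yb : `|y| <= b^-1 * (expR (b * y) + expR (- b * y)).
    rewrite mulrC ler_pdivlMr// mulrC -[X in X * `|y|]gtr0_norm// -normrM.
    have := expR_ge1Dx (b * y); have := expR_ge1Dx (- b * y).
    have := expR_gt0 (b * y); have := expR_gt0 (- b * y).
    by move=> h1 h2 h3 h4; rewrite ler_norml; apply/andP; split; lra.
  have YE r u : expR (u * y) * Y r = Y (r + u).
    by rewrite /Y /gamma_kernel -expRD; congr expR; ring.
  have Yle r : b <= r <= 9 * b -> Y r <= Y b + Y (9 * b).
    move=> /andP[br rb]; have [y0|y0] := leP 0 y.
      rewrite -[leLHS]add0r lerD ?gamma_kernel_ge0// ler_expR lerD2r.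
      by rewrite ler_wpM2r.
    rewrite -[leLHS]addr0 lerD ?gamma_kernel_ge0// ler_expR lerD2r.
    by rewrite ler_wnM2r// ltW.
  have tb : b <= t + b <= 9 * b by lra.
  have tNb : b <= t + - b <= 9 * b by lra.
  rewrite normrM [X in _ * X]ger0_norm ?gamma_kernel_ge0//.
  apply: (le_trans (ler_wpM2r (gamma_kernel_ge0 _ _ _) yb)).
  rewrite -mulrA mulrDl -/(Y t) !YE.
  have := Yle _ tb; have := Yle _ tNb => h1 h2.
  rewrite /G -/(Y b) -/(Y (9 * b)) -mulrA mulrCA ler_wpM2l ?invr_ge0 ?(ltW b0)//.
  lra.
split; last first.
  apply: (le_integrable measurableT _ _ Gi).
    apply/measurable_EFinP; apply: measurable_funM => //.
    exact: measurable_gamma_kernel.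
  move=> y _; rewrite /= lee_fin (le_trans (yG s y _)) ?ler_norm//.
  by apply/andP; split; lra.
rewrite (_ : Gamma = fun t => \int[mu]_y gamma_kernel t 1 y); last first.
  by apply/funext => t; rewrite GammaE.
refine (@is_derive_under_integral _ _ _ mu (gamma_kernel ^~ 1)
  (fun t y => y * gamma_kernel t 1 y) G s (s / 2) (2 * s) _ _ _ yG Gi).
- by apply/andP; split; lra.
- by move=> t /andP[t0 _]; apply: integrable_gamma_kernel => //; lra.
- by move=> t y _; exact: is_derive_gamma_kernel_shape.
Qed.

(** Translating y by -ln a absorbs the rate into the factor a^(-s). *)
Lemma integral_gamma_kernel_rate (s a : R) : 0 < s -> 0 < a ->
  \int[mu]_y gamma_kernel s a y = expR (- s * ln a) * Gamma s.
Proof.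
move=> s0 a0; rewrite GammaE -RintegralZl//; last exact: integrable_gamma_kernel.
rewrite /Rintegral; congr fine.
rewrite (@ge0_integral_affine _ 1 (- ln a) (EFin \o gamma_kernel s a)) ?oner_neq0//.
- apply: eq_integral => y _; rewrite normr1 mule1 mul1r /= /gamma_kernel -expRD.
  rewrite [expR (y - ln a)]expRD expRN lnK ?posrE//; congr (expR _)%:E; field.
  by rewrite gt_eqF.
- by apply/measurable_EFinP; exact: measurable_gamma_kernel.
- by move=> y; rewrite lee_fin gamma_kernel_ge0.
Qed.

(** The integral of [gamma_kernel s a] is differentiated at a = 1 in two ways: under the integral
    sign, giving -Gamma (s + 1), and in the closed form a^(-s) Gamma s, giving -s Gamma s. *)
Lemma GammaD1 (s : R) : 0 < s -> Gamma (s + 1) = s * Gamma s.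
Proof.
move=> s0; have s10 : 0 < s + 1 by rewrite addr_gt0.
have h1 : is_derive (1 : R) (1 : R) (fun a => \int[mu]_y gamma_kernel s a y)
    (\int[mu]_y (- gamma_kernel (s + 1) 1 y)).
  (* Rates in []1/2, 2[] are dominated by the kernel with the smallest rate, 1/2. *)
  refine (@is_derive_under_integral _ _ _ mu (gamma_kernel s)
    (fun a y => - gamma_kernel (s + 1) a y) (gamma_kernel (s + 1) 2^-1)
    1 2^-1 2 _ _ _ _ _).
  - by apply/andP; split; lra.
  - by move=> a /andP[a0 _]; apply: integrable_gamma_kernel => //; lra.
  - by move=> a y _; exact: is_derive_gamma_kernel_rate.
  - move=> a y /andP[a0 _]; rewrite normrN ger0_norm ?gamma_kernel_ge0//.
    by rewrite ler_expR lerB// ler_wpM2r ?expR_ge0// ltW.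
  - by apply: integrable_gamma_kernel => //; rewrite invr_gt0.
have h2 : is_derive (1 : R) (1 : R) (fun a => expR (- s * ln a) * Gamma s)
    (- s * Gamma s).
  have -> : (fun a => expR (- s * ln a) * Gamma s)
      = Gamma s \*: (expR \o (- s \*: @ln R)).
    by apply/funext => a; rewrite mulrC.
  have dln := is_deriveZ (- s) (is_derive1_ln (@ltr01 R)).
  apply: (is_derive_eq (is_deriveZ (Gamma s)
    (is_derive1_comp (is_derive_expR _) dln))).
  by rewrite /GRing.scale/= ln1 scaler0 expR0 divr1 mul1r mulrC.
have : \int[mu]_y (- gamma_kernel (s + 1) 1 y) = - s * Gamma s.
  rewrite -(@derive_val _ _ _ _ _ _ _ h1) -(@derive_val _ _ _ _ _ _ _ h2).
  (* The closed form is known for positive a only, which covers a neighbourhood of 1. *)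
  apply: near_eq_derive => //; near=> a; apply: integral_gamma_kernel_rate => //.
  by near: a; exact: lt_nbhsr.
move=> h; apply: oppr_inj; rewrite -mulNr -h.
under [in RHS]eq_Rintegral do rewrite -mulN1r.
rewrite RintegralZl//; last exact: integrable_gamma_kernel.
by rewrite -GammaE mulN1r.
Unshelve. all: end_near. Qed.

End gamma_function.

(** * Entropy and law of a randomly rotated variable *)

(** The definition picks some density by choice. Any two densities have equal integrals over all
    measurable sets and finite total mass, so they agree almost everywhere and give the same
    entropy. *)
Lemma differential_entropyE (d : measure_display) (T : measurableType d)
    (R : realType) (P : probability T R) (d' : measure_display)
    (T' : measurableType d') (mu : {measure set T' -> \bar R}) (X : T -> T')
    (f : T' -> R) : has_pdf P mu X f ->
  differential_entropy P mu X = (- \int[mu]_x (f x * log2 (f x))%:E)%E.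
Proof.
move=> Xf; rewrite /differential_entropy; case: pselect => [exf|]; last first.
  by move=> nex; exfalso; apply: nex; exists f.
case: cid => g /= [mX mg g0 gP]; case: Xf => _ mf f0 fP.
congr (- _)%E.
have gi : mu.-integrable setT (EFin \o g).
  apply/integrableP; split; first exact/measurable_EFinP.
  under eq_integral do rewrite /= ger0_norm//.
  by rewrite -gP// preimage_setT probability_setT ltry.
have gf : ae_eq mu setT (EFin \o g) (EFin \o f).
  apply: integral_ae_eq => //; first exact/measurable_EFinP.
  by move=> E _ mE; rewrite -gP// -fP.
have mlog (h : T' -> R) : measurable_fun setT h ->
    measurable_fun setT (fun x : T' => (h x * log2 (h x))%:E).
  move=> mh; apply/measurable_EFinP; apply: measurable_funM => //.
  by apply: measurable_funM => //; apply: measurableT_comp.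
apply: ae_eq_integral => //; [exact: mlog|exact: mlog|].
by apply: filterS gf => x + xT => /(_ xT) [->].
Qed.

Section independent_pdf.
Context {d : measure_display} {T : measurableType d} {R : realType}.
Variable P : probability T R.
Notation mu := (@lebesgue_measure R).
Notation RR := (measurableTypeR R * measurableTypeR R)%type.
Local Open Scope ereal_scope.

Lemma ge0_integral_independent (X Y : {RV P >-> R}) (f g : R -> R)
    (F : RR -> \bar R) :
  has_pdf P mu X f -> has_pdf P mu Y g -> independent_RV X Y ->
  measurable_fun setT F -> (forall z, 0 <= F z) ->
  \int[P]_t F (X t, Y t) =
  \int[mu]_y (\int[mu]_x (F (x, y) * (f x)%:E) * (g y)%:E).
Proof.
move=> [mX mf f0 fP] [mY mg g0 gP] XY mF F0.
pose X' : {mfun T >-> measurableTypeR R} :=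
  HB.pack (X : T -> measurableTypeR R) (isMeasurableFun.Build _ _ _ _ _ mX).
pose Y' : {mfun T >-> measurableTypeR R} :=
  HB.pack (Y : T -> measurableTypeR R) (isMeasurableFun.Build _ _ _ _ _ mY).
have mXY : measurable_fun setT (fun t => (X t, Y t) : RR).
  by apply/measurable_fun_pairP; split.
pose PXY := measure_function_pushforward__canonical__measure_function_Measure P mXY.
transitivity (\int[PXY]_z F z).
  by rewrite (ge0_integral_pushforward mXY P)// preimage_setT.
(* Independence says that the joint law agrees with the product of the marginals on rectangles,
   which determines it. *)
rewrite (@eq_measure_integral _ _ _ _
  (distribution P X' \x distribution P Y')); last first.
  move=> A mA _; apply/esym/(product_measure_unique (m1 := distribution P X')
    (m2 := distribution P Y') (m' := PXY)) => // B C mB mC; exact: XY.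
rewrite (fubini_tonelli2 F mF F0) /fubini_G.
rewrite (@ge0_integral_density _ _ _ mu g mg g0)//; last 2 first.
- exact: (@measurable_fun_fubini_tonelli_G _ _ _ _ _ (distribution P X') F mF F0).
- by move=> y; exact: integral_ge0.
apply: eq_integral => y _; congr (_ * _).
rewrite (@ge0_integral_density _ _ _ mu f mf f0)//.
exact: (measurable_fun_pair1 y mF).
Qed.

End independent_pdf.

Section isotropic.
Context {R : realType}.
Notation mu := (@lebesgue_measure R).
Notation RR := (measurableTypeR R * measurableTypeR R)%type.

Definition plane_norm (z : RR) : R := Num.sqrt (z.1 ^+ 2 + z.2 ^+ 2).

Lemma measurable_plane_norm : measurable_fun setT plane_norm.
Proof.
apply: (measurableT_comp (f := @Num.sqrt R)).
  by apply: continuous_measurable_fun; exact: sqrt_continuous.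
by apply: measurable_funD; apply: measurable_funX.
Qed.

Lemma plane_norm_polar (s theta : R) :
  plane_norm (expR s * cos theta, expR s * sin theta) = expR s.
Proof.
rewrite /plane_norm/= !exprMn -mulrDr cos2Dsin2 mulr1 sqrtr_sqr ger0_norm//.
Qed.

(* Applied to positive and negative parts, a substitution rule for nonnegative
   functions holds for every measurable function. *)
Lemma integral_transfer (d1 d2 : measure_display) (T1 : measurableType d1)
    (T2 : measurableType d2) (mu1 : {measure set T1 -> \bar R})
    (mu2 : {measure set T2 -> \bar R}) (phi : T1 -> R) (psi w : T2 -> R) :
  (forall y, 0 <= w y) ->
  (forall k : R -> R, measurable_fun setT k -> (forall x, (0 <= k x)%R) ->
    \int[mu1]_x (k (phi x))%:E = \int[mu2]_y (w y * k (psi y))%:E)%E ->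
  forall h : R -> R, measurable_fun setT h ->
    (\int[mu1]_x (h (phi x))%:E = \int[mu2]_y (w y * h (psi y))%:E)%E.
Proof.
move=> w0 H h mh; rewrite [LHS]integralE [RHS]integralE; congr (_ - _)%E.
- transitivity (\int[mu1]_x (Num.max (h (phi x)) 0)%:E)%E.
    by apply: eq_integral => x _; rewrite funeposE EFin_max.
  rewrite (H (fun x => Num.max (h x) 0)).
  + apply: eq_integral => y _; rewrite funeposE -EFin_max.
    by rewrite maxr_pMr// mulr0.
  + exact: measurable_maxr.
  + by move=> x; rewrite le_max lexx orbT.
- transitivity (\int[mu1]_x (Num.max (- h (phi x)) 0)%:E)%E.
    by apply: eq_integral => x _; rewrite funenegE EFin_max.
  rewrite (H (fun x => Num.max (- h x) 0)).
  + apply: eq_integral => y _; rewrite funenegE -EFinN -EFin_max.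
    by rewrite maxr_pMr// mulr0 mulrN.
  + by apply: measurable_maxr => //; exact: measurableT_comp.
  + by move=> x; rewrite le_max lexx orbT.
Qed.

(** A radial integrand is constant in the angle, which contributes [2 * pi]. Signed [h] are covered
    because the entropy integrand changes sign. *)
Lemma integral_plane_norm (h : R -> R) : measurable_fun setT h ->
  (\int[mu \x mu]_z (h (plane_norm z))%:E =
   \int[mu]_s (2 * pi * expR s ^+ 2 * h (expR s))%:E)%E.
Proof.
apply: (integral_transfer (mu1 := (mu \x mu)%E) (mu2 := mu)
  (w := fun s => 2 * pi * expR s ^+ 2)).
  by move=> s; rewrite mulr_ge0 ?sqr_ge0// mulr_ge0 ?pi_ge0.
move=> k mk k0.
have mkr : measurable_fun setT (fun z : RR => (k (plane_norm z))%:E).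
  apply/measurable_EFinP; apply: (measurableT_comp mk).
  exact: measurable_plane_norm.
rewrite (ge0_integral_polar mkr); last by move=> z; rewrite lee_fin.
transitivity (\int[mu]_(theta in `[0%R, (2 * pi)%R])
    \int[mu]_s (k (expR s) * expR s ^+ 2)%:E)%E.
  apply: eq_integral => theta _; apply: eq_integral => s _.
  by rewrite plane_norm_polar.
have mke : measurable_fun setT (fun s : R => (k (expR s) * expR s ^+ 2)%:E).
  apply/measurable_EFinP; apply: measurable_funM; last exact: measurable_funX.
  exact: measurableT_comp.
rewrite integral_cst//= lebesgue_measure_itv/= lte_fin mulr_gt0 ?pi_gt0//.
rewrite -EFinB subr0 -ge0_integralZr//.
- by apply: eq_integral => s _; rewrite -EFinM; congr EFin; ring.
- by move=> s _; rewrite lee_fin mulr_ge0 ?sqr_ge0.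
- by rewrite lee_fin mulr_ge0 ?pi_ge0.
Qed.

Lemma integral_affine (a b : R) (h : R -> R) : a != 0 -> measurable_fun setT h ->
  (\int[mu]_x (h x)%:E = \int[mu]_y (`|a| * h (a * y + b)%R)%:E)%E.
Proof.
move=> a0; apply: (integral_transfer (mu1 := mu) (mu2 := mu) (phi := idfun)
  (psi := fun y => a * y + b) (w := fun=> `|a|)) => // k mk k0.
rewrite (ge0_integral_affine b a0 (f := EFin \o k))//.
- by apply: eq_integral => y _; rewrite -EFinM mulrC.
- exact/measurable_EFinP.
Qed.

(** For a test set [A], both sides become integrals over the angle and s = ln r. The law gives f(r)
    / 2 pi times dr = r ds, the planar density gives f(r) / (2 pi r) times r^2 ds, and these
    agree. *)
Lemma has_pdf_polar (d : measure_display) (T : measurableType d)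
    (P : probability T R) (X Theta : {RV P >-> R}) (f : R -> R) :
  has_pdf P mu X f -> (forall x, x < 0 -> f x = 0) ->
  uniform_RV 0 (2 * pi) Theta -> independent_RV X Theta ->
  has_pdf P (mu \x mu)%E (fun t => (X t * cos (Theta t), X t * sin (Theta t)) : RR)
    (fun z => f (plane_norm z) / (2 * pi * plane_norm z)).
Proof.
move=> Xf fneg Thetau XTheta.
have [mX mf f0 fP] := Xf; have [mTheta _ _ _] := Thetau.
pose V t : RR := (X t * cos (Theta t), X t * sin (Theta t)).
(* At the origin the quotient is 0, since the inverse of 0 is 0; a single point carries no area. *)
pose q (z : RR) := f (plane_norm z) / (2 * pi * plane_norm z).
have mW : measurable_fun setT V.
  apply/measurable_fun_pairP; split.
    by apply: measurable_funM => //; apply: (measurableT_comp measurable_cos).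
  by apply: measurable_funM => //; apply: (measurableT_comp measurable_sin).
have mq : measurable_fun setT q.
  apply: measurable_funM.
    by apply: (measurableT_comp mf); exact: measurable_plane_norm.
  apply: (measurableT_comp measurable_inv).
  by apply: measurable_funM => //; exact: measurable_plane_norm.
have q0 (z : RR) : 0 <= q z.
  by rewrite divr_ge0// mulr_ge0 ?sqrtr_ge0// mulr_ge0 ?pi_ge0.
split => // A mA.
pose F (z : RR) : \bar R := (\1_A ((z.1 * cos z.2, z.1 * sin z.2) : RR))%:E.
have mF : measurable_fun setT F.
  apply/measurable_EFinP; apply: (measurableT_comp (measurable_indic mA)).
  apply/measurable_fun_pairP; split.
    apply: measurable_funM; first exact: measurable_fst.
    by apply: (measurableT_comp measurable_cos); exact: measurable_snd.
  apply: measurable_funM; first exact: measurable_fst.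
  by apply: (measurableT_comp measurable_sin); exact: measurable_snd.
have F0 z : (0 <= F z)%E by rewrite lee_fin.
transitivity (\int[P]_t F (X t, Theta t))%E.
  rewrite -[RHS]/(\int[P]_t (\1_(V @^-1` A) t)%:E)%E integral_indic ?setIT//.
  by rewrite -[X in measurable X]setTI; exact: mW.
rewrite (ge0_integral_independent Xf Thetau XTheta mF F0).
rewrite [RHS]integral_mkcond.
rewrite (ge0_integral_polar (F := (EFin \o q) \_ A)); last 2 first.
- apply/(measurable_restrictT (EFin \o q)) => //.
  apply/measurable_EFinP; exact: measurable_funTS.
- by move=> z; apply: erestrict_ge0 => w; rewrite lee_fin.
rewrite [RHS]integral_mkcond; apply: eq_integral => theta _.
rewrite patchE mem_setE in_itv/= /uniform_pdf.
case: ifPn => thetaI; last by rewrite mule0.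
have mFt : measurable_fun setT (fun x : R => F (x, theta) * (f x)%:E)%E.
  apply: emeasurable_funM; last exact/measurable_EFinP.
  exact: (measurable_fun_pair1 theta mF).
have fF0 (x : R) : (0 <= F (x, theta) * (f x)%:E)%E by rewrite mule_ge0// lee_fin.
(* Negative radii carry no mass by [fneg], and the radius 0 is negligible. *)
transitivity ((\int[mu]_(x in `]0%R, +oo[) (F (x, theta) * (f x)%:E)) *
    (2 * pi - 0)^-1%:E)%E.
  congr (_ * _)%E.
  rewrite integral_itv_obnd_cbnd; last exact: measurable_funTS.
  rewrite [RHS]integral_mkcond; apply: eq_integral => x _.
  rewrite patchE mem_setE in_itv/= andbT; case: leP => // x0.
  by rewrite fneg// mule0.
transitivity ((\int[mu]_s (F (expR s, theta) * (f (expR s))%:E * (expR s)%:E)) *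
    (2 * pi - 0)^-1%:E)%E.
  congr (_ * _)%E.
  rewrite -(ge0_integral_ln (f := (fun x => F (x, theta) * (f x)%:E)%E \o expR))//.
  - apply: eq_integral => x; rewrite inE/= in_itv/= andbT => x0.
    by rewrite lnK.
  - exact: (measurableT_comp mFt).
  - by move=> y; exact: fF0.
rewrite -ge0_integralZr//.
- apply: eq_integral => s _; rewrite patchE /= /q plane_norm_polar /F/= indicE.
  case: ifPn => _; last by rewrite !mul0e.
  rewrite mul1e -!EFinM; congr EFin; rewrite subr0.
  move: (@pi R) (pi_gt0 R) => p p0; field.
  by rewrite !gt_eqF ?expR_gt0.
- apply: emeasurable_funM => //; last exact/measurable_EFinP.
  exact: (measurableT_comp mFt).
- by move=> s _; rewrite mule_ge0// lee_fin expR_ge0.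
- by rewrite lee_fin invr_ge0 subr0 mulr_ge0 ?pi_ge0.
Qed.

End isotropic.

(** * Evaluation of the entropy integral *)

Lemma digammaE (R : realType) (s : R) : 0 < s ->
  digamma s =
    (\int[lebesgue_measure]_y (y * gamma_kernel s 1 y)) / Gamma s.
Proof.
move=> s0; have [dG _] := is_derive_Gamma s0.
have dln := is_derive1_ln (Gamma_gt0 s0).
have dc := is_derive1_comp dln dG.
by rewrite /digamma derive1E -[fun y => _]/(@ln R \o Gamma) derive_val mulrC.
Qed.

(** This is the shape taken by density times log-density: a kernel times its exponent, affine in y
    minus e^y. The three terms are separately integrable, which justifies splitting the
    extended-real integral. *)
Lemma integral_log_gamma_kernel (R : realType) (m k a b : R) : 0 < m ->
  (\int[lebesgue_measure]_y
     (k * (gamma_kernel m 1 y * (a + b * y - expR y)))%:E =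
   (k * (a * Gamma m + b * (digamma m * Gamma m) - m * Gamma m))%:E)%E.
Proof.
move=> m0; have [_ Di] := is_derive_Gamma m0.
have m10 : 0 < m + 1 by rewrite addr_gt0.
have Gm0 := Gamma_gt0 m0.
have i0 := integrable_gamma_kernel m0 (@ltr01 R).
have i1 := integrable_gamma_kernel m10 (@ltr01 R).
have fineE (h : R -> R) : lebesgue_measure.-integrable setT (EFin \o h) ->
    (\int[lebesgue_measure]_y (h y)%:E = (\int[lebesgue_measure]_y h y)%:E)%E.
  by move=> hi; rewrite /Rintegral fineK//; exact: integrable_fin_num.
transitivity (\int[lebesgue_measure]_y
   (k%:E * ((a%:E * (gamma_kernel m 1 y)%:E + b%:E * (y * gamma_kernel m 1 y)%:E)
    - (gamma_kernel (m + 1) 1 y)%:E)))%E.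
  apply: eq_integral => y _.
  transitivity (k * (a * gamma_kernel m 1 y + b * (y * gamma_kernel m 1 y)
    - gamma_kernel (m + 1) 1 y))%:E; last by [].
  congr EFin.
  (* The factor e^y raises the shape to m + 1. *)
  rewrite (_ : gamma_kernel (m + 1) 1 y = gamma_kernel m 1 y * expR y).
    by ring.
  by rewrite /gamma_kernel -expRD; congr expR; ring.
have ia := integrableZl measurableT a i0; have ib := integrableZl measurableT b Di.
rewrite integralZl//; last by apply: integrableB => //; exact: integrableD.
rewrite integralB//; last exact: integrableD.
rewrite integralD// !integralZl//.
rewrite (fineE (gamma_kernel m 1))// (fineE (gamma_kernel (m + 1) 1))//.
rewrite (fineE (fun y => y * gamma_kernel m 1 y))//.
rewrite -!GammaE GammaD1// digammaE// divfK ?gt_eqF//.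
Qed.

(** The planar density at radius e^s is put as a single exponential, so that its logarithm can be
    read off. Dividing by the radius lowers the power 2m - 1 to 2m - 2. *)
Lemma nakagami_pdf_expR (R : realType) (m Omega s : R) : 0 < m -> 0 < Omega ->
  nakagami_pdf m Omega (expR s) / (2 * pi * expR s) =
  expR (m * ln (m / Omega) - ln (pi * Gamma m) + (2 * m - 2) * s
        - expR (2 * s + ln (m / Omega))).
Proof.
move=> m0 Omega0; have Gm0 := Gamma_gt0 m0; have pi0 := pi_gt0 R.
have mO0 : 0 < m / Omega by rewrite divr_gt0.
rewrite /nakagami_pdf expR_ge0 /powR !gt_eqF ?expR_gt0//.
rewrite expRK.
have -> : expR (2 * s + ln (m / Omega)) = m * expR s ^+ 2 / Omega.
  rewrite expRD lnK ?posrE// mulr2n mulrDl mul1r expRD; field; exact: lt0r_neq0.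
rewrite !expRD [expR (- ln _)]expRN lnK ?posrE ?mulr_gt0//.
have -> : expR ((2 * m - 1) * s) = expR ((2 * m - 2) * s) * expR s.
  by rewrite -expRD; congr expR; ring.
move: (@pi R) pi0 (expR s) (expR_gt0 s) => p p0 e e0.
by field; rewrite !gt_eqF.
Qed.

Theorem proposition4 (R : realType) (d : measure_display)
    (T : measurableType d) (P : probability T R)
    (m Omega : R) (hm : 2^-1 <= m) (hOmega : 0 < Omega)
    (W : T -> R[i]) (hW : complex_nakagami P m Omega W) :
  complex_differential_entropy P W =
    (1 / (2 * ln 2) * digamma m
     + log2 (pi * Omega / m * Gamma m
             * expR ((2 * m - (2 * m - 1) * digamma m) / 2)))%:E.
Proof.
have m0 : 0 < m by rewrite (lt_le_trans _ hm)// invr_gt0.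
have Gm0 := Gamma_gt0 m0; have pi0 := pi_gt0 R.
case: hW => X [] Theta [] Xpdf Thetau XTheta WE.
have fneg x : x < 0 -> nakagami_pdf m Omega x = 0.
  by move=> x0; rewrite /nakagami_pdf leNgt x0.
have [_ mf _ _] := Xpdf.
have Wpdf := has_pdf_polar Xpdf fneg Thetau XTheta.
rewrite /complex_differential_entropy.
rewrite (_ : (fun t => (complex.Re (W t), complex.Im (W t))) =
  (fun t => (X t * cos (Theta t), X t * sin (Theta t)))); last first.
  by apply/funext => t; rewrite WE /= !mul0r subr0 addr0.
rewrite (differential_entropyE Wpdf).
pose c := ln (m / Omega); pose L : R := ln 2.
have L0 : 0 < L by rewrite ln_gt0// ltr1n.
pose q x := nakagami_pdf m Omega x / (2 * pi * x).
have mq : measurable_fun setT q.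
  apply: measurable_funM => //; apply: (measurableT_comp measurable_inv).
  exact: measurable_funM.
have mh : measurable_fun setT (fun x => q x * log2 (q x)).
  apply: measurable_funM => //; apply: measurable_funM => //.
  exact: measurableT_comp.
rewrite -[in LHS]/(\int[_]_z ((fun x => q x * log2 (q x)) (plane_norm z))%:E)%E.
rewrite (integral_plane_norm mh).
(* With y = 2s + c = ln (m r^2 / Omega), the term (2m - 2) s of the log-density is (m - 1)(y - c),
   and [a] gathers the constants. In [H] the weight 2 pi r^2 turns the density into 2 / Gamma m
   times the kernel; the 2 is the Jacobian of s -> y, and [L] converts to bits. *)
pose a := m * c - ln (pi * Gamma m) - (m - 1) * c.
pose H y := (Gamma m * L)^-1 * (gamma_kernel m 1 y * (a + (m - 1) * y - expR y)).
have mH : measurable_fun setT H.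
  apply: measurable_funM => //; apply: measurable_funM.
    exact: measurable_gamma_kernel.
  apply: measurable_funB => //; apply: measurable_funD => //.
transitivity (- \int[lebesgue_measure]_y (H y)%:E)%E.
  congr (- _)%E.
  rewrite [RHS](@integral_affine _ 2 c H)//.
  apply: eq_integral => s _; congr EFin.
  rewrite /q nakagami_pdf_expR// -/c /log2 expRK -/L ger0_norm// /H.
  set E1 := m * c - _ + _ * s - _.
  have -> : a + (m - 1) * (2 * s + c) - expR (2 * s + c) = E1.
    by rewrite /a /E1; ring.
  have -> : expR E1 = gamma_kernel m 1 (2 * s + c) / (pi * Gamma m * expR s ^+ 2).
    rewrite -[pi * Gamma m]lnK ?posrE ?mulr_gt0// expr2 -!expRD -expRN -expRD.
    by congr expR; rewrite /E1; ring.
  move: (@pi R) pi0 (expR s) (expR_gt0 s) => p p0 e e0.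
  by field; rewrite !gt_eqF.
rewrite integral_log_gamma_kernel// -EFinN; congr EFin.
rewrite /log2 -/L.
(* Here [a] equals c - ln (pi Gamma m), so this form exposes the same two logarithms on the right.
   The digamma terms match because 1/2 - (2m - 1)/2 = 1 - m. *)
have -> : pi * Omega / m * Gamma m = pi * Gamma m / (m / Omega).
  move: (@pi R) pi0 => p p0; field; rewrite !gt_eqF//.
rewrite lnM ?posrE ?expR_gt0 ?divr_gt0 ?mulr_gt0// expRK.
rewrite ln_div ?posrE ?divr_gt0 ?mulr_gt0// -/c /a.
move: (ln (pi * Gamma m)) => l; move: (digamma m) => psi.
by field; rewrite !gt_eqF.
Qed.
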